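(* Let $0<t<\hat t$. The lasso estimate $\beta^{lasso}(t)=(\beta_1^{lasso}(t),\dots,\beta_p^{lasso}(t))$ gives the coordinates of the point of contact of the boundary $B(t)$ with the ellipsoid $E_{\mu(t)}$. When this point of contact belongs to the interior of a face of $B(t)$ of the maximal dimension $p-1$, the gradient at that point of the function defining the ellipsoid $E_{\mu(t)}$ is collinear with the normal $\delta$ to the face, and they are of opposite orientations. If the point of contact belongs to the interior of a face of $B(t)$ of a smaller dimension $j$, $j<p-1$, then $p-1-j$ of its coordinates are equal to zero and the face belongs to the tangent hyperplane of the ellipsoid at the point of contact.
   Context: Let $p\ge2$. A data set consists of $N$ points $(x_1^{(i)},\dots,x_p^{(i)},y^{(i)})\in\mathbb R^{p+1}$ with centroid at the origin and not contained in any proper affine subspace (full rank assumption). Put $K_1=\frac1N\sum_i x^{(i)}(x^{(i)})^T$ ($p\times p$, positive definite), $b=\frac1N\sum_i y^{(i)}x^{(i)}\in\mathbb R^p$, $J_{yy}=\frac1N\sum_i(y^{(i)})^2$, $\hat\beta=K_1^{-1}b$, $\hat t=\sum_j|\hat\beta_j|$. For $t>0$ the lasso estimate $\beta^{lasso}(t)$ is the minimizer of $\frac12\sum_i\big(y^{(i)}-\sum_j\beta_jx_j^{(i)}\big)^2$ over $\beta\in\mathbb R^p$ with $\sum_j|\beta_j|\le t$ (the intercept is $0$ since the data are centered). Let $B(t)=\{\beta\in\mathbb R^p:\sum_j|\beta_j|=t\}$ (a cross-polytope boundary). For real $\mu$, let $$E_\mu=\{\beta\in\mathbb R^p:\ \langle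 K_1(\beta-\hat\beta),\beta-\hat\beta\rangle=\mu+\langle K_1^{-1}b,b\rangle-J_{yy}\},$$ the defining function being the left-hand side. $\mu(t)$ is the smallest $\mu$ for which $E_\mu$ touches (meets) $B(t)$. The normal to a $(p-1)$-dimensional face of $B(t)$ is its outward normal, i.e. the vector $\delta\in\{-1,1\}^p$ of signs of the points in its interior. *)

(* Defs.v *)
From HB Require Import structures.
From mathcomp Require Import all_boot all_order all_algebra.
From mathcomp Require Import all_classical all_reals all_analysis.
Set Implicit Arguments.
Unset Strict Implicit.
Unset Printing Implicit Defensive.
Import Order.TTheory GRing.Theory Num.Theory.
Import numFieldNormedType.Exports.
Local Open Scope classical_set_scope.
Local Open Scope ring_scope.

Definition dot (R : realType) (n : nat) (u v : 'cV[R]_n) : R := (u^T *m v) 0 0.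

Definition l1norm (R : realType) (n : nat) (u : 'cV[R]_n) : R :=
  \sum_(j < n) `|u j 0|.

(* The vector of partial derivatives. *)
Definition gradient (R : realType) (n : nat) (f : 'cV[R]_n -> R)
    (a : 'cV[R]_n) : 'cV[R]_n :=
  \col_j 'D_(delta_mx j 0) (f : 'cV[R]_n -> R^o) a.

(* Tangent hyperplane at [a] to the level set of [f] through [a]; it exists
   only when the gradient of [f] at [a] does not vanish. *)
Definition is_tangent_hyperplane (R : realType) (n : nat) (f : 'cV[R]_n -> R)
    (a : 'cV[R]_n) (H : set 'cV[R]_n) : Prop :=
  gradient f a != 0 /\ H = [set z | dot (gradient f a) (z - a) = 0].

Definition is_least (R : realType) (A : set R) (m : R) : Prop :=
  A m /\ lbound A m.

(* The intersection of all the affine subspaces [a + V] containing [F]. *)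
Definition aff_hull (R : realType) (n : nat) (F : set 'cV[R]_n) :
    set 'cV[R]_n :=
  [set z | forall (a : 'cV[R]_n) (V : {vspace 'cV[R]_n}),
    (forall x, F x -> x - a \in V) -> z - a \in V].

Definition has_aff_dim (R : realType) (n : nat) (F : set 'cV[R]_n) (d : nat) :
    Prop :=
  exists (a : 'cV[R]_n) (V : {vspace 'cV[R]_n}),
    \dim V = d /\ aff_hull F = [set z | z - a \in V].

(* Interior of [F] relative to its affine hull; this is the meaning of the
   interior of a face, so that a vertex is its own interior. *)
Definition relint (R : realType) (n : nat) (F : set 'cV[R]_n) :
    set 'cV[R]_n :=
  [set z | F z /\ \forall w \near z, aff_hull F w -> F w].

Definition is_polytope_face (R : realType) (n : nat) (P F : set 'cV[R]_n) :
    Prop :=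
  exists (c : 'cV[R]_n) (a : R),
    (forall z, P z -> dot c z <= a) /\ F = [set z | P z /\ dot c z = a].

Definition cross_polytope (R : realType) (n : nat) (t : R) : set 'cV[R]_n :=
  [set z | l1norm z <= t].

Definition cross_boundary (R : realType) (n : nat) (t : R) : set 'cV[R]_n :=
  [set z | l1norm z = t].

Definition is_boundary_face (R : realType) (n : nat) (t : R)
    (F : set 'cV[R]_n) : Prop :=
  is_polytope_face (@cross_polytope R n t) F /\ F `<=` @cross_boundary R n t.

(* Outward normal to a face [F] of dimension [n - 1], normalised to have
   entries +1 and -1: the common signs of the points in the interior of [F]. *)
Definition is_face_normal (R : realType) (n : nat) (t : R)
    (F : set 'cV[R]_n) (delta : 'cV[R]_n) : Prop :=
  [/\ forall j, delta j 0 = 1 \/ delta j 0 = -1,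
      forall z j, relint F z -> Num.sg (z j 0) = delta j 0 &
      forall z w, F z -> cross_polytope t w -> dot delta w <= dot delta z].

Definition data_point (R : realType) (p N : nat) (x : 'I_N -> 'cV[R]_p)
    (y : 'I_N -> R) (i : 'I_N) : 'cV[R]_(p + 1) :=
  col_mx (x i) (y i)%:M.

Definition centered (R : realType) (p N : nat) (x : 'I_N -> 'cV[R]_p)
    (y : 'I_N -> R) : Prop :=
  N%:R^-1 *: (\sum_i data_point x y i) = 0.

Definition full_rank (R : realType) (p N : nat) (x : 'I_N -> 'cV[R]_p)
    (y : 'I_N -> R) : Prop :=
  aff_hull (range (data_point x y)) = setT.

Definition K1 (R : realType) (p N : nat) (x : 'I_N -> 'cV[R]_p) : 'M[R]_p :=
  N%:R^-1 *: \sum_i (x i *m (x i)^T).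

Definition bvec (R : realType) (p N : nat) (x : 'I_N -> 'cV[R]_p)
    (y : 'I_N -> R) : 'cV[R]_p :=
  N%:R^-1 *: \sum_i (y i *: x i).

Definition Jyy (R : realType) (N : nat) (y : 'I_N -> R) : R :=
  N%:R^-1 * \sum_i y i ^+ 2.

Definition beta_hat (R : realType) (p N : nat) (x : 'I_N -> 'cV[R]_p)
    (y : 'I_N -> R) : 'cV[R]_p :=
  invmx (K1 x) *m bvec x y.

Definition t_hat (R : realType) (p N : nat) (x : 'I_N -> 'cV[R]_p)
    (y : 'I_N -> R) : R :=
  l1norm (beta_hat x y).

Definition lasso_objective (R : realType) (p N : nat) (x : 'I_N -> 'cV[R]_p)
    (y : 'I_N -> R) (beta : 'cV[R]_p) : R :=
  2^-1 * \sum_i (y i - \sum_(j < p) beta j 0 * x i j 0) ^+ 2.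

Definition is_lasso (R : realType) (p N : nat) (x : 'I_N -> 'cV[R]_p)
    (y : 'I_N -> R) (t : R) (beta : 'cV[R]_p) : Prop :=
  l1norm beta <= t /\
  forall beta' : 'cV[R]_p, l1norm beta' <= t ->
    lasso_objective x y beta <= lasso_objective x y beta'.

Definition ellipsoid_fun (R : realType) (p N : nat) (x : 'I_N -> 'cV[R]_p)
    (y : 'I_N -> R) (beta : 'cV[R]_p) : R :=
  dot (K1 x *m (beta - beta_hat x y)) (beta - beta_hat x y).

Definition ellipsoid (R : realType) (p N : nat) (x : 'I_N -> 'cV[R]_p)
    (y : 'I_N -> R) (mu : R) : set 'cV[R]_p :=
  [set beta | ellipsoid_fun x y beta =
     mu + dot (invmx (K1 x) *m bvec x y) (bvec x y) - Jyy y].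

Definition is_contact_level (R : realType) (p N : nat) (x : 'I_N -> 'cV[R]_p)
    (y : 'I_N -> R) (t mu : R) : Prop :=
  is_least [set m | ellipsoid x y m `&` @cross_boundary R p t !=set0] mu.

(* Main.v *)
(* Write [b] for the lasso estimate and [g = K1 (b - beta_hat)], half the
   gradient at [b] of the function defining the ellipsoid; up to an affine
   change, the lasso objective is that function. Minimality amounts to
   [<g, b> <= <g, z>] on the cross-polytope, and [g <> 0] because [beta_hat]
   lies outside it. A point [u] of the relative interior of a face determines
   the direction of the affine hull of the face: the vectors [v] supported on
   the support of [u] with [<sg u, v> = 0]. This space has dimension
   [p - 1 - #zeros of u], and any linear functional minimal at [u] over the
   cross-polytope vanishes on it. For [u = b] this gives the tangency, and, when
   no coordinate vanishes, that [g] is a multiple of [sg b], negative since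
   [<g, b> <= <g, 0>]. *)

Require Import Defs.
From HB Require Import structures.
From mathcomp Require Import all_boot all_order all_algebra.
From mathcomp Require Import all_classical all_reals all_analysis.
From mathcomp Require Import ring lra.
Set Implicit Arguments.
Unset Strict Implicit.
Unset Printing Implicit Defensive.
Import Order.TTheory GRing.Theory Num.Theory.
Import numFieldNormedType.Exports.
Local Open Scope classical_set_scope.
Local Open Scope ring_scope.

(** * Algebra of the dot product *)

Lemma dotE (R : realType) (n : nat) (u v : 'cV[R]_n) :
  dot u v = \sum_j u j 0 * v j 0.
Proof. by rewrite /dot mxE; apply: eq_bigr => j _; rewrite mxE. Qed.

Lemma dotC (R : realType) (n : nat) (u v : 'cV[R]_n) : dot u v = dot v u.
Proof. by rewrite !dotE; apply: eq_bigr => j _; rewrite mulrC. Qed.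

Lemma dotDr (R : realType) (n : nat) (u v w : 'cV[R]_n) :
  dot u (v + w) = dot u v + dot u w.
Proof. by rewrite /dot mulmxDr mxE. Qed.

Lemma dotZr (R : realType) (n : nat) (u v : 'cV[R]_n) (a : R) :
  dot u (a *: v) = a * dot u v.
Proof. by rewrite /dot -scalemxAr mxE. Qed.

Lemma dotNr (R : realType) (n : nat) (u v : 'cV[R]_n) :
  dot u (- v) = - dot u v.
Proof. by rewrite /dot mulmxN mxE. Qed.

Lemma dotDl (R : realType) (n : nat) (u v w : 'cV[R]_n) :
  dot (v + w) u = dot v u + dot w u.
Proof. by rewrite !(dotC _ u) dotDr. Qed.

Lemma dotZl (R : realType) (n : nat) (u v : 'cV[R]_n) (a : R) :
  dot (a *: v) u = a * dot v u.
Proof. by rewrite !(dotC _ u) dotZr. Qed.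

Lemma dotNl (R : realType) (n : nat) (u v : 'cV[R]_n) :
  dot (- v) u = - dot v u.
Proof. by rewrite !(dotC _ u) dotNr. Qed.

Lemma dot0r (R : realType) (n : nat) (u : 'cV[R]_n) : dot u 0 = 0.
Proof. by rewrite /dot mulmx0 mxE. Qed.

Lemma dot_suml (R : realType) (n : nat) (I : finType) (f : I -> 'cV[R]_n)
  (u : 'cV[R]_n) : dot (\sum_i f i) u = \sum_i dot (f i) u.
Proof.
by apply: (big_morph (fun v => dot v u)) => [v w|]; rewrite ?dotDl // dotC dot0r.
Qed.

Lemma dot_delta (R : realType) (n : nat) (u : 'cV[R]_n) (k : 'I_n) :
  dot u (delta_mx k 0) = u k 0.
Proof. by rewrite /dot -colE !mxE. Qed.

Lemma dot_self_gt0 (R : realType) (n : nat) (u : 'cV[R]_n) :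
  u != 0 -> 0 < dot u u.
Proof.
move=> u0; rewrite dotE lt_neqAle sumr_ge0 => [|j _]; last by rewrite -expr2 sqr_ge0.
rewrite andbT eq_sym; apply: contra u0 => /eqP/psumr_eq0P h.
apply/eqP/colP => j; rewrite mxE; apply/eqP; rewrite -sqrf_eq0 expr2 h // => i _.
by rewrite -expr2 sqr_ge0.
Qed.

(** * The l1 norm and sign vectors *)

Lemma l1norm_ge0 (R : realType) (n : nat) (u : 'cV[R]_n) : 0 <= l1norm u.
Proof. exact: sumr_ge0. Qed.

Lemma ler_l1normD (R : realType) (n : nat) (u v : 'cV[R]_n) :
  l1norm (u + v) <= l1norm u + l1norm v.
Proof. by rewrite /l1norm -big_split ler_sum // => j _; rewrite mxE ler_normD. Qed.

Lemma l1normZ (R : realType) (n : nat) (a : R) (u : 'cV[R]_n) :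
  l1norm (a *: u) = `|a| * l1norm u.
Proof. by rewrite /l1norm mulr_sumr; apply: eq_bigr => j _; rewrite mxE normrM. Qed.

Lemma l1norm0 (R : realType) (n : nat) : l1norm (0 : 'cV[R]_n) = 0.
Proof. by rewrite /l1norm big1 // => j _; rewrite mxE normr0. Qed.

Lemma l1norm_convex (R : realType) (n : nat) (t s : R) (u v : 'cV[R]_n) :
  l1norm u <= t -> l1norm v <= t -> 0 <= s <= 1 ->
  l1norm (u + s *: (v - u)) <= t.
Proof.
move=> ut vt /andP[s0 s1].
have -> : u + s *: (v - u) = (1 - s) *: u + s *: v.
  by rewrite scalerBr scalerBl scale1r addrA addrAC.
apply: le_trans (ler_l1normD _ _) _; rewrite !l1normZ !ger0_norm ?subr_ge0 //.
have := ler_wpM2l s0 vt; have s1' : 0 <= 1 - s by rewrite subr_ge0.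
by have := ler_wpM2l s1' ut; lra.
Qed.

Definition sgvec {R : realType} {n : nat} (u : 'cV[R]_n) : 'cV[R]_n :=
  \col_j Num.sg (u j 0).

Lemma dot_sgvec_self (R : realType) (n : nat) (u : 'cV[R]_n) :
  dot (sgvec u) u = l1norm u.
Proof. by rewrite dotE; apply: eq_bigr => j _; rewrite mxE -normrEsg. Qed.

Lemma ler_sgM_norm (R : realType) (a b : R) : Num.sg a * b <= `|b|.
Proof.
apply: le_trans (ler_norm _) _; rewrite normrM normr_sg.
by case: eqP => _; rewrite ?mul0r ?mul1r.
Qed.

Lemma dot_sgvec_le (R : realType) (n : nat) (u v : 'cV[R]_n) :
  dot (sgvec u) v <= l1norm v.
Proof. by rewrite dotE ler_sum // => j _; rewrite mxE ler_sgM_norm. Qed.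

(** The differences [|v j 0| - sg (u j 0) * v j 0] are nonnegative and sum to zero, so each of them
    vanishes. *)
Lemma dot_sgvec_eq (R : realType) (n : nat) (u v : 'cV[R]_n) :
  dot (sgvec u) v = l1norm v -> forall k, `|v k 0| = Num.sg (u k 0) * v k 0.
Proof.
move=> e k; apply/eqP; rewrite -subr_eq0; apply/eqP.
have /psumr_eq0P : \sum_j (`|v j 0| - Num.sg (u j 0) * v j 0) = 0.
  rewrite sumrB -/(l1norm v) -e dotE.
  by under eq_bigr do rewrite mxE; rewrite subrr.
by apply=> // j _; rewrite subr_ge0 ler_sgM_norm.
Qed.

(** * The direction of a face of the cross-polytope *)

(** The linear conditions cutting out the direction of a face, one row each, so that the dimension
    of their kernel follows from rank and nullity. *)
Definition face_mx {R : realType} {n : nat} (u : 'cV[R]_n) :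
    'M[R]_(#|[pred k | u k 0 == 0]| + 1, n) :=
  col_mx (rowsub (fun i => enum_val i) 1%:M) (sgvec u)^T.

(* The direction of the affine hull of the face of the cross-polytope having
   [u] in its relative interior. *)
Definition face_dir {R : realType} {n : nat} (u : 'cV[R]_n) :
    {vspace 'cV[R]_n} :=
  lker (linfun (mulmx (face_mx u) : 'cV[R]_n -> 'cV[R]_(_))).

Lemma face_dirP (R : realType) (n : nat) (u v : 'cV[R]_n) :
  reflect ((forall k, u k 0 = 0 -> v k 0 = 0) /\ dot (sgvec u) v = 0)
    (v \in face_dir u).
Proof.
rewrite memv_ker lfunE /= mul_col_mx -[eqbRHS]vsubmxK.
apply: (iffP eqP).
  move/eq_col_mx => []; rewrite mul_rowsub_mx mul1mx => h1 h2; split.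
    move=> k /eqP uk; have kin : k \in [pred k | u k 0 == 0] by [].
    have := congr1 (fun M : 'cV_ _ => M (enum_rank_in kin k) 0) h1.
    by rewrite !mxE enum_rankK_in.
  by rewrite /dot h2 !mxE.
move=> [h1 h2]; congr col_mx; last first.
  by apply/matrixP => i j; rewrite !ord1 -/(dot _ _) h2 !mxE.
rewrite mul_rowsub_mx mul1mx; apply/colP => i; rewrite !mxE.
by apply: h1; apply/eqP; have := enum_valP i; rewrite inE.
Qed.

(** For [u != 0] the rows of [face_mx u] are independent: the map is onto, and the rank-nullity
    formula gives the dimension of its kernel. *)
Lemma dim_face_dir (R : realType) (n : nat) (u : 'cV[R]_n) : u != 0 ->
  (\dim (face_dir u) + (#|[pred k | u k 0%R == 0%R]| + 1) = n)%N.
Proof.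
move=> u0.
have := limg_ker_dim (linfun (mulmx (face_mx u) : 'cV[R]_n -> 'cV[R]_(_))) fullv.
rewrite capfv -/(face_dir u) (_ : limg _ = fullv); last first.
  apply/vspaceP => w; rewrite memvf; apply/idP.
  have t0 : l1norm u != 0.
    apply: contra u0 => /eqP/psumr_eq0P h; apply/eqP/colP => k.
    by rewrite mxE; apply/eqP; rewrite -normr_eq0 h.
  (* A preimage of [w]: [v1] puts the prescribed values at the zeros of [u]; adding a multiple of
     [u] then adjusts the last entry, as [<sg u, u>] is the nonzero [l1norm u], and leaves the zeros
     of [u] untouched. *)
  pose v1 : 'cV[R]_n :=
    (rowsub (fun i : 'I_#|[pred k | u k 0 == 0]| => enum_val i) 1%:M)^T *m usubmx w.
  pose v := v1 + ((dsubmx w 0 0 - dot (sgvec u) v1) / l1norm u) *: u.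
  suff -> : w = linfun (mulmx (face_mx u) : 'cV[R]_n -> 'cV[R]_(_)) v.
    exact/memv_img/memvf.
  rewrite lfunE /= mul_col_mx -[LHS]vsubmxK; congr col_mx; last first.
    rewrite [RHS]mx11_scalar -/(dot _ _) dotDr dotZr dot_sgvec_self.
    by rewrite [LHS]mx11_scalar; congr (_%:M); rewrite divfK // addrC subrK.
  rewrite mul_rowsub_mx mul1mx; apply/colP => i; rewrite !mxE.
  have /eqP -> : u (enum_val i) 0 == 0 by have := enum_valP i; rewrite inE.
  rewrite mulr0 addr0 (bigD1 i) //= big1 ?addr0 => [|j ji]; rewrite !mxE ?eqxx ?mul1r //.
  by rewrite (inj_eq enum_val_inj) (negPf ji) mul0r.
by rewrite !dimvf /dim /= !muln1.
Qed.

(** * Small steps along a face *)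

Lemma near_line (R : realType) (n : nat) (A : set 'cV[R]_n) (u v : 'cV[R]_n) :
  (\forall w \near u, A w) -> exists2 s : R, 0 < s & A (u + s *: v).
Proof.
move=> nA; have c : u + s *: v @[s --> (0 : R)] --> u.
  suff: u + s *: v @[s --> (0 : R)] --> u + 0 *: v by rewrite scale0r addr0.
  by apply: cvgD; [exact: cvg_cst|apply: cvgZr_tmp; exact: cvg_id].
have /nbhs_ballP[e /= e0 he] := c _ nA.
exists (e / 2); first by rewrite divr_gt0.
by apply: he; rewrite /ball /= sub0r normrN ger0_norm ?ltr_pdivrMr ?ltr_pMr ?divr_ge0 ?ltr1n // ltW.
Qed.

(** Provides a step so small that no coordinate of [u + s *: v] takes the sign opposite to that of
    [u]. *)
Lemma scale_le_coord (R : realType) (n : nat) (u v : 'cV[R]_n) :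
  (forall k, u k 0 = 0 -> v k 0 = 0) ->
  exists2 s : R, 0 < s & forall k, s * `|v k 0| <= `|u k 0|.
Proof.
(* The summand 1 keeps the denominator positive where [v] vanishes. *)
move=> h; pose f k := if u k 0 == 0 then 1 else `|u k 0| / (1 + `|v k 0|).
have v1 k : 0 < 1 + `|v k 0| by rewrite ltr_wpDr.
exists (\big[Num.min/1]_k f k).
  apply: lt_bigmin => // k _; rewrite /f; case: eqP => // /eqP uk.
  by rewrite divr_gt0 ?normr_gt0.
move=> k; have [uk|uk] := eqVneq (u k 0) 0; first by rewrite h // normr0 mulr0.
apply: le_trans (_ : f k * `|v k 0| <= _).
  by rewrite ler_wpM2r // bigmin_le.
rewrite /f (negPf uk) mulrAC ler_pdivrMr // ler_wpM2l //.
by rewrite lerDr.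
Qed.

(** As long as no sign is reversed, the l1 norm agrees with the linear functional [<sg u, _>], which
    is constant along [v]. *)
Lemma l1norm_face_dir (R : realType) (n : nat) (u v : 'cV[R]_n) :
  v \in face_dir u -> exists2 s : R, 0 < s & l1norm (u + s *: v) = l1norm u.
Proof.
move=> /face_dirP[h hd]; have [s s0 hs] := scale_le_coord h.
exists s => //; rewrite -(dot_sgvec_self u) -[RHS]addr0 -(mulr0 s) -hd.
rewrite -dotZr -dotDr dotE; apply: eq_bigr => k _; rewrite !mxE.
have := hs k; rewrite -[X in X * _]gtr0_norm // -normrM => {}hs.
have [u0|u0|u0] := sgrP (u k 0).
- by rewrite u0 h // mulr0 addr0 normr0 mul0r.
- rewrite mul1r ger0_norm //; move: hs; rewrite (ger0_norm (ltW u0)) ler_norml.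
  lra.
- rewrite mulN1r ler0_norm //; move: hs; rewrite (ler0_norm (ltW u0)) ler_norml.
  lra.
Qed.

(** A small step along [v] stays on the sphere of radius [l1norm u], so [<c, v> >= 0]; the same
    holds for [- v]. *)
Lemma linear_min_face_dir (R : realType) (n : nat) (c u v : 'cV[R]_n) :
  (forall z, l1norm z <= l1norm u -> dot c u <= dot c z) ->
  v \in face_dir u -> dot c v = 0.
Proof.
move=> hmin; wlog suff hw : v / v \in face_dir u -> 0 <= dot c v.
  move=> hv; apply/le_anti; rewrite hw // andbT -oppr_ge0 -dotNr.
  by apply: hw; rewrite rpredN.
move=> /l1norm_face_dir[s s0 e]; have := hmin (u + s *: v).
by rewrite e lexx dotDr dotZr lerDl pmulr_rge0 // => /(_ isT).
Qed.

(** * Affine hull, dimension and signs of a boundary face *)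

Lemma sub_aff_hull (R : realType) (n : nat) (F : set 'cV[R]_n) : F `<=` aff_hull F.
Proof. by move=> z Fz a V; apply. Qed.

(** The segment from [z] to [u] can be prolonged a little beyond [u] inside [F]. The functional
    [<sg u, _>] is at most [t] on [F] and equals [t] at [u]; a smaller value at [z] would force a
    value above [t] beyond [u]. *)
Lemma boundary_face_sg (R : realType) (n : nat) (t : R) (F : set 'cV[R]_n)
    (u z : 'cV[R]_n) :
  is_boundary_face t F -> relint F u -> F z ->
  l1norm z = t /\ dot (sgvec u) z = t.
Proof.
move=> [_ FB] [Fu nu] Fz; split; first exact: FB.
have [s s0 hs] := near_line (u - z) nu.
have {}hs : F (u + s *: (u - z)).
  apply: hs => a V h; rewrite addrAC rpredD ?h // rpredZ //.
  by rewrite -[u - z](subrKA a) -[a - z]opprB rpredB ?h.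
have := dot_sgvec_le u (u + s *: (u - z)).
have := dot_sgvec_le u z; rewrite (FB _ hs) (FB _ Fz).
rewrite dotDr dotZr dotDr dotNr dot_sgvec_self (FB _ Fu) => h1.
rewrite gerDl pmulr_rle0 // subr_le0 => h2; exact/le_anti/andP.
Qed.

(** One inclusion is the sign relation on [F]. For the other, a small step from [u] along the
    direction keeps both the l1 norm and the functional that defines [F], so it ends in [F], and the
    hull contains the whole line through [u] and that endpoint. *)
Lemma aff_hull_boundary_face (R : realType) (n : nat) (t : R)
    (F : set 'cV[R]_n) (u : 'cV[R]_n) :
  is_boundary_face t F -> relint F u ->
  aff_hull F = [set z | z - u \in face_dir u].
Proof.
move=> hF hu; have [FB Fu] := (hF.2, hu.1).
have ut := FB _ Fu; rewrite /cross_boundary /= in ut.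
apply/seteqP; split=> z /=.
  apply=> w Fw; have [wt sw] := boundary_face_sg hF hu Fw.
  apply/face_dirP; split=> [k uk|]; last by rewrite dotDr dotNr sw dot_sgvec_self ut subrr.
  rewrite !mxE uk subr0; apply/normr0_eq0.
  by rewrite (@dot_sgvec_eq _ _ u) ?sw ?wt // uk sgr0 mul0r.
move=> hz; have [[c [a [hc eF]]] _] := hF.
have [s s0 hs] := l1norm_face_dir hz.
suff Fs : F (u + s *: (z - u)).
  move=> b V h; have := h _ Fs; rewrite addrAC (rpredDl _ (h _ Fu)).
  rewrite rpredZeq gt_eqF //= => hV.
  by rewrite -[z](subrK u) -addrA rpredD // h.
move: Fu; rewrite eF => -[_ cu]; split; first by rewrite /cross_polytope /= hs ut.
(* The face maximises [c], hence minimises [- c]. *)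
rewrite dotDr dotZr; suff: dot (- c) (z - u) = 0.
  by rewrite dotNl => /eqP; rewrite oppr_eq0 => /eqP ->; rewrite mulr0 addr0.
apply: linear_min_face_dir hz => w; rewrite !dotNl lerN2 cu ut; exact: hc.
Qed.

(** Both [V] and [face_dir u] are directions of the affine hull of [F], so they coincide; [t > 0]
    ensures [u != 0]. *)
Lemma boundary_face_dim (R : realType) (n : nat) (t : R)
    (F : set 'cV[R]_n) (u : 'cV[R]_n) (d : nat) :
  0 < t -> is_boundary_face t F -> relint F u -> has_aff_dim F d ->
  (d + (#|[pred k | u k 0%R == 0%R]| + 1) = n)%N.
Proof.
move=> t0 hF hu [a [V [<- eV]]].
rewrite -[RHS](@dim_face_dir _ _ u); last first.
  apply/negP => /eqP u0; have := hF.2 _ hu.1; rewrite u0 /cross_boundary /= l1norm0.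
  by move=> e; move: t0; rewrite -e ltxx.
congr (\dim _ + _)%N; apply/vspaceP => v.
have eq w : (w - a \in V) = (w - u \in face_dir u).
  have := aff_hull_boundary_face hF hu; rewrite eV => /seteqP[h1 h2].
  by apply/idP/idP; [apply: h1|apply: h2].
have ua : u - a \in V by rewrite eq subrr mem0v.
by have := eq (u + v); rewrite (addrAC u v (- u)) subrr add0r addrAC rpredDl.
Qed.

Lemma boundary_face_sgvec (R : realType) (n : nat) (t : R)
    (F : set 'cV[R]_n) (u z : 'cV[R]_n) (k : 'I_n) :
  is_boundary_face t F -> relint F u -> F z -> z k 0 != 0 ->
  Num.sg (z k 0) = Num.sg (u k 0).
Proof.
move=> hF hu Fz zk; have [h1 h2] := boundary_face_sg hF hu Fz.
have := @dot_sgvec_eq _ _ u z; rewrite h1 h2 => /(_ erefl k).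
by rewrite normrEsg => /(mulIf zk).
Qed.

(** * Quadratic forms and their gradient *)

Lemma dot_sym_mul (R : realType) (n : nat) (K : 'M[R]_n) (u v : 'cV[R]_n) :
  K^T = K -> dot (K *m u) v = dot (K *m v) u.
Proof.
by move=> Ks; rewrite [RHS]dotC /dot trmx_mul Ks mulmxA.
Qed.

Lemma quad_expand (R : realType) (n : nat) (K : 'M[R]_n) (w v : 'cV[R]_n) :
  K^T = K -> dot (K *m (w + v)) (w + v) =
    dot (K *m w) w + 2 * dot (K *m w) v + dot (K *m v) v.
Proof.
by move=> Ks; rewrite mulmxDr !dotDr !dotDl (dot_sym_mul v w Ks); ring.
Qed.

Lemma gradient_quad (R : realType) (n : nat) (K : 'M[R]_n) (b a : 'cV[R]_n) :
  K^T = K -> gradient (fun z => dot (K *m (z - b)) (z - b)) a =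
    2 *: (K *m (a - b)).
Proof.
move=> Ks; apply/colP => j; rewrite mxE [RHS]mxE /derive.
set v := delta_mx j 0; apply/cvg_lim => //.
have -> : (K *m (a - b)) j 0 = dot (K *m (a - b)) v by rewrite dot_delta.
(* For [h != 0] the difference quotient is exactly this affine function of [h]. *)
have c : 2 * dot (K *m (a - b)) v + h * dot (K *m v) v @[h --> (0 : R)^']
    --> 2 * dot (K *m (a - b)) v + 0 * dot (K *m v) v.
  apply: cvgD; first exact: cvg_cst.
  by apply: cvgMr_tmp; exact: nbhs_dnbhs.
rewrite mul0r addr0 in c; apply: cvg_trans c; apply: near_eq_cvg.
near=> h; have h0 : h != 0 by near: h; exact: nbhs_dnbhs_neq.
rewrite /= /shift /= (addrC (h *: v)) (addrAC a) (quad_expand (a - b) _ Ks).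
rewrite -scalemxAr !dotZr dotZl [_ *: _]mulrC; field.
Unshelve. all: by end_near.
Qed.

(** * Positive definiteness of [K1] *)

Lemma K1_mul (R : realType) (p N : nat) (x : 'I_N -> 'cV[R]_p) (u : 'cV[R]_p) :
  K1 x *m u = N%:R^-1 *: \sum_i (dot (x i) u *: x i).
Proof.
rewrite /K1 -scalemxAl mulmx_suml; congr (_ *: _); apply: eq_bigr => i _.
by rewrite -mulmxA [_^T *m u]mx11_scalar mul_mx_scalar.
Qed.

Lemma K1_sym (R : realType) (p N : nat) (x : 'I_N -> 'cV[R]_p) :
  (K1 x)^T = K1 x.
Proof.
rewrite /K1 linearZ /= raddf_sum; congr (_ *: _); apply: eq_bigr => i _.
by rewrite /= trmx_mul trmxK.
Qed.

Lemma K1_quad (R : realType) (p N : nat) (x : 'I_N -> 'cV[R]_p) (u : 'cV[R]_p) :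
  dot (K1 x *m u) u = N%:R^-1 * \sum_i dot (x i) u ^+ 2.
Proof.
rewrite K1_mul dotZl dot_suml; congr (_ * _).
by apply: eq_bigr => i _; rewrite dotZl expr2.
Qed.

(* A vector [u] in the kernel of the form is orthogonal to every [x i], which
   puts the data in the hyperplane [(u, 0)^T w = 0]. *)
Lemma K1_quad_gt0 (R : realType) (p N : nat) (x : 'I_N -> 'cV[R]_p)
    (y : 'I_N -> R) (u : 'cV[R]_p) :
  full_rank x y -> u != 0 -> 0 < dot (K1 x *m u) u.
Proof.
move=> hr u0; rewrite lt_neqAle K1_quad mulr_ge0 ?invr_ge0 ?ler0n ?sumr_ge0 //; last first.
  by move=> i _; exact: sqr_ge0.
rewrite andbT; apply/negP => /eqP/esym/eqP e.
have xu i : dot (x i) u = 0.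
  (* The factor [N^-1] vanishes only for [N = 0], and then there is no index [i]. *)
  move: e; rewrite mulf_eq0 invr_eq0 pnatr_eq0 => /orP[/eqP N0|/eqP/psumr_eq0P h].
    by have := ltn_ord i; rewrite [X in (_ < X)%N]N0.
  by apply/eqP; rewrite -sqrf_eq0 h // => j _; exact: sqr_ge0.
pose c : 'cV[R]_(p + 1) := col_mx u 0.
pose V := lker (linfun (mulmx c^T : 'cV[R]_(p + 1) -> 'cV[R]_1)).
have VE w : (w \in V) = (c^T *m w == 0) by rewrite memv_ker lfunE.
(* Full rank puts the normal [c] of the hyperplane into the hyperplane itself, whence
   [<c, c> = 0]. *)
have : aff_hull (range (data_point x y)) c by rewrite hr.
move=> /(_ 0 V); rewrite subr0 VE; move=> h; have {}h : c^T *m c = 0.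
  apply/eqP/h => _ [i _ <-]; rewrite subr0 VE /c tr_col_mx mul_row_col trmx0 mul0mx addr0.
  by apply/eqP/matrixP => j k; rewrite !ord1 -/(dot _ _) dotC xu mxE.
have := dot_self_gt0 u0; move: h; rewrite /c tr_col_mx mul_row_col trmx0 mul0mx addr0 /dot => ->.
by rewrite mxE ltxx.
Qed.

Lemma K1_unit (R : realType) (p N : nat) (x : 'I_N -> 'cV[R]_p)
    (y : 'I_N -> R) : full_rank x y -> K1 x \in unitmx.
Proof.
move=> hr; rewrite -row_free_unit; apply/inj_row_free => v vK.
apply/eqP; rewrite -trmx_eq0; apply/negPn/negP => /(K1_quad_gt0 hr).
have -> : K1 x *m v^T = 0 by apply: trmx_inj; rewrite trmx_mul trmxK K1_sym vK trmx0.
by rewrite dotC dot0r ltxx.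
Qed.

(** * The ellipsoid function and the lasso objective *)

Lemma ellipsoid_fun_expand (R : realType) (p N : nat) (x : 'I_N -> 'cV[R]_p)
    (y : 'I_N -> R) (u v : 'cV[R]_p) :
  ellipsoid_fun x y (u + v) = ellipsoid_fun x y u
    + 2 * dot (K1 x *m (u - beta_hat x y)) v + dot (K1 x *m v) v.
Proof. by rewrite /ellipsoid_fun addrAC (quad_expand (u - _) v (K1_sym x)). Qed.

Lemma gradient_ellipsoid_fun (R : realType) (p N : nat) (x : 'I_N -> 'cV[R]_p)
    (y : 'I_N -> R) (u : 'cV[R]_p) :
  gradient (ellipsoid_fun x y) u = 2 *: (K1 x *m (u - beta_hat x y)).
Proof. exact/gradient_quad/K1_sym. Qed.

(** Both sides are quadratic in [u] with form [K1] up to the factor [N / 2], and the normal equation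
    [K1 *m beta_hat = bvec] matches their linear terms. *)
Lemma lasso_objectiveE (R : realType) (p N : nat) (x : 'I_N -> 'cV[R]_p)
    (y : 'I_N -> R) (u : 'cV[R]_p) : (0 < N)%N -> K1 x \in unitmx ->
  lasso_objective x y u = N%:R / 2 *
    (ellipsoid_fun x y u + Jyy y - dot (bvec x y) (beta_hat x y)).
Proof.
move=> N0 Ku; have N0' : N%:R != 0 :> R by rewrite pnatr_eq0 -lt0n.
rewrite /lasso_objective.
have -> : \sum_i (y i - \sum_(j < p) u j 0 * x i j 0) ^+ 2 =
    \sum_i y i ^+ 2 - 2 * \sum_i dot (y i *: x i) u + \sum_i dot (x i) u ^+ 2.
  rewrite mulr_sumr -sumrB -big_split; apply: eq_bigr => i _ /=.
  by rewrite dotZl (dotC _ u) dotE; ring.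
rewrite -dot_suml.
have -> : \sum_i (y i *: x i) = N%:R *: bvec x y by rewrite /bvec scalerA divff ?scale1r.
have -> : \sum_i y i ^+ 2 = N%:R * Jyy y by rewrite /Jyy mulVKf.
have -> : \sum_i dot (x i) u ^+ 2 = N%:R * dot (K1 x *m u) u by rewrite K1_quad mulVKf.
have Kb : K1 x *m beta_hat x y = bvec x y by rewrite /beta_hat mulKVmx.
rewrite /ellipsoid_fun quad_expand ?K1_sym // mulmxN !dotNr dotNl Kb.
rewrite (dot_sym_mul u _ (K1_sym x)) Kb dotZl.
by field.
Qed.

Lemma is_lasso_ellipsoid (R : realType) (p N : nat) (x : 'I_N -> 'cV[R]_p)
    (y : 'I_N -> R) (t : R) (u : 'cV[R]_p) : (0 < N)%N -> K1 x \in unitmx ->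
  is_lasso x y t u <-> l1norm u <= t /\
  forall v, l1norm v <= t -> ellipsoid_fun x y u <= ellipsoid_fun x y v.
Proof.
move=> N0 Ku; have N0' : 0 < N%:R / 2 :> R by rewrite divr_gt0 ?ltr0n.
by split=> -[h1 h2]; split=> // v hv; have := h2 _ hv;
  rewrite !lasso_objectiveE // ler_pM2l // !lerD2r.
Qed.

(** First-order condition on a convex set: along the segment from [u] to [z] the function changes by
    [s * (2 * g + s * a)], which is negative for small [s > 0] if [g < 0]. *)
Lemma lasso_variational (R : realType) (p N : nat) (x : 'I_N -> 'cV[R]_p)
    (y : 'I_N -> R) (t : R) (u z : 'cV[R]_p) :
  l1norm u <= t ->
  (forall v, l1norm v <= t -> ellipsoid_fun x y u <= ellipsoid_fun x y v) ->
  l1norm z <= t ->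
  dot (K1 x *m (u - beta_hat x y)) u <= dot (K1 x *m (u - beta_hat x y)) z.
Proof.
move=> ut hu zt; rewrite -[z](subrKC u) dotDr lerDl.
set v := z - u; set g := dot _ v.
have K0 : 0 <= dot (K1 x *m v) v.
  by rewrite K1_quad mulr_ge0 ?invr_ge0 ?ler0n ?sumr_ge0 // => i _; exact: sqr_ge0.
set a := dot _ _ in K0; rewrite leNgt; apply/negP => g0.
have ag : 0 < a - g by rewrite subr_gt0 (lt_le_trans g0).
(* This [s] lies in []0, 1]] and satisfies [s * a <= - g], so that [2 * g + s * a <= g < 0]; the
   denominator is positive even when [a = 0]. *)
pose s := - g / (a - g).
have s0 : 0 < s by rewrite divr_gt0 // oppr_gt0.
have s1 : s <= 1 by rewrite ler_pdivrMr // mul1r lerDr.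
have s01 : 0 <= s <= 1 by rewrite ltW.
have := hu _ (l1norm_convex ut zt s01); rewrite ellipsoid_fun_expand.
rewrite -scalemxAr !dotZr dotZl -/g -/a -addrA lerDl.
have -> : 2 * (s * g) + s * (s * a) = s * (2 * g + s * a) by ring.
rewrite pmulr_rge0 // leNgt => /negP; apply.
have : s * a <= - g.
  by rewrite mulrAC ler_pdivrMr // ler_wpM2l ?lerDl ?oppr_ge0 ?ltW //; lra.
lra.
Qed.

(** * Existence, strictness and location of the minimum *)

Lemma ellipsoid_fun_min_exists (R : realType) (p N : nat)
    (x : 'I_N -> 'cV[R]_p) (y : 'I_N -> R) (t : R) : 0 <= t ->
  exists2 u, l1norm u <= t &
    forall v, l1norm v <= t -> ellipsoid_fun x y u <= ellipsoid_fun x y v.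
Proof.
(* Passing to row vectors, closed bounded sets are compact and the extreme value theorem applies. *)
move=> t0; pose A := [set v : 'rV[R]_p | l1norm v^T <= t].
have cs (f : 'I_p -> 'rV[R]_p -> R) : (forall i, continuous (f i)) ->
    continuous (fun v => \sum_i f i v).
  by move=> cf; apply: continuous_big => // ; exact: add_continuous.
have cc i : continuous (fun v : 'rV[R]_p => v^T i 0).
  rewrite (_ : (fun v : 'rV[R]_p => _) = (fun v : 'rV[R]_p => v 0 i)).
    exact: coord_continuous.
  by apply/funext => v; rewrite mxE.
have cl : closed A.
  rewrite (_ : A = (fun v : 'rV[R]_p => l1norm v^T) @^-1` [set r | r <= t]) //.
  apply: closed_comp; last exact: closed_le.
  move=> v _; apply: cs => i w; apply: continuous_comp; [exact: cc|exact: norm_continuous].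
have cA : compact A.
  apply: bounded_closed_compact => //; exists t; split; first exact: num_real.
  move=> M tM v vA; rewrite /Num.norm /= mx_normrE; apply/bigmax_leP; split.
    by rewrite (le_trans t0) // ltW.
  move=> [i j] _ /=; rewrite ord1; apply: le_trans (ltW tM); apply: le_trans vA.
  rewrite /l1norm (bigD1 j) //= mxE lerDl; exact: sumr_ge0.
have A0 : A !=set0 by exists 0; rewrite /A /= trmx0 l1norm0.
have cf : continuous (fun v : 'rV[R]_p => ellipsoid_fun x y v^T).
  have cd i : continuous (fun v : 'rV[R]_p => (v^T - beta_hat x y) i 0).
    rewrite (_ : (fun v : 'rV[R]_p => _) = (fun v : 'rV[R]_p => v^T i 0 - beta_hat x y i 0)).
      by move=> v; apply: continuousB; [exact: cc|exact: cst_continuous].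
    by apply/funext => v; rewrite !mxE.
  have cK i : continuous (fun v : 'rV[R]_p => (K1 x *m (v^T - beta_hat x y)) i 0).
    rewrite (_ : (fun v : 'rV[R]_p => _) =
      (fun v : 'rV[R]_p => \sum_j K1 x i j * (v^T - beta_hat x y) j 0)).
      by apply: cs => j v; apply: continuousM; [exact: cst_continuous|exact: cd].
    by apply/funext => v; rewrite mxE.
  rewrite /ellipsoid_fun; under eq_fun do rewrite dotE.
  by apply: cs => i v; apply: continuousM; [exact: cK|exact: cd].
have [c cin hc] := compact_EVT_min A0 cA (continuous_subspaceT cf).
exists c^T; first by move: cin; rewrite inE.
by move=> v vt; rewrite -[v]trmxK; apply: hc; rewrite inE /A /= trmxK.
Qed.

(** For [N = 0] the convention [0^-1 = 0] makes the form [K1] vanish, against its positivity at a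
    unit vector. *)
Lemma full_rank_gt0 (R : realType) (p N : nat) (x : 'I_N -> 'cV[R]_p)
    (y : 'I_N -> R) : (0 < p)%N -> full_rank x y -> (0 < N)%N.
Proof.
case: p x => // p x _ hr; have : (delta_mx 0 0 : 'cV[R]_p.+1) != 0.
  apply/negP => /eqP/matrixP/(_ 0 0)/eqP.
  by rewrite !mxE !eqxx oner_eq0.
move=> /(K1_quad_gt0 hr); rewrite K1_quad; case: N x y {hr} => // x y.
by rewrite invr0 mul0r ltxx.
Qed.

(** In the expansion at [u] the first-order term is nonnegative by hypothesis and the second-order
    term is positive. *)
Lemma ellipsoid_fun_strict_min (R : realType) (p N : nat)
    (x : 'I_N -> 'cV[R]_p) (y : 'I_N -> R) (u v : 'cV[R]_p) :
  full_rank x y ->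
  dot (K1 x *m (u - beta_hat x y)) u <= dot (K1 x *m (u - beta_hat x y)) v ->
  v != u -> ellipsoid_fun x y u < ellipsoid_fun x y v.
Proof.
move=> hr huv vu; have := K1_quad_gt0 hr (_ : v - u != 0).
rewrite subr_eq0 vu => /(_ isT) q0.
rewrite -[v](subrKC u) ellipsoid_fun_expand -addrA ltrDl dotDr dotNr.
lra.
Qed.

(* Otherwise a small step from [u] along [- g] would stay in the polytope. *)
Lemma linear_min_boundary (R : realType) (n : nat) (t : R) (g u : 'cV[R]_n) :
  0 < t -> g != 0 -> l1norm u <= t ->
  (forall z, l1norm z <= t -> dot g u <= dot g z) -> l1norm u = t.
Proof.
move=> t0 g0 ut hmin; apply/le_anti; rewrite ut /= leNgt; apply/negP => lt.
have l1 : 0 < 1 + l1norm g by rewrite ltr_wpDr ?l1norm_ge0.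
(* With this [s] the l1 norm of [s *: g] is at most the slack [t - l1norm u]. *)
pose s := (t - l1norm u) / (1 + l1norm g).
have s0 : 0 < s by rewrite divr_gt0 // subr_gt0.
have : l1norm (u + - s *: g) <= t.
  apply: le_trans (ler_l1normD _ _) _; rewrite l1normZ normrN gtr0_norm //.
  rewrite -lerBrDl mulrAC ler_pdivrMr // ler_wpM2l ?subr_ge0 //.
  by rewrite lerDr.
move=> /hmin; rewrite dotDr dotZr mulNr lerDl oppr_ge0 pmulr_rle0 //.
by rewrite leNgt dot_self_gt0.
Qed.

(** * Normals to the faces of maximal dimension *)

(** The dimension count leaves no zero coordinate in the relative interior, so all its points share
    the signs of [u]; and [<sg u, _>] equals [t] on [F] and is at most [t] on the polytope. *)
Lemma has_aff_dim_face_normal (R : realType) (p : nat) (t : R)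
    (F : set 'cV[R]_p) (u : 'cV[R]_p) :
  (0 < p)%N -> 0 < t -> is_boundary_face t F -> has_aff_dim F (p - 1)%N ->
  relint F u -> is_face_normal t F (sgvec u).
Proof.
move=> p0 t0 hF hd hu.
have nz z : relint F z -> forall k, z k 0 != 0.
  move=> hz k; have := boundary_face_dim t0 hF hz hd.
  rewrite addnCA subnK // => /(congr1 (subn^~ p)); rewrite addnK subnn => /card0_eq.
  by move=> /(_ k); rewrite inE => ->.
split.
- move=> k; rewrite mxE; have := nz _ hu k; rewrite neq_lt => /orP[h|h].
    by right; rewrite ltr0_sg.
  by left; rewrite gtr0_sg.
- move=> z k hz; rewrite mxE; exact: boundary_face_sgvec hF hu hz.1 (nz _ hz k).
- move=> z w Fz wt; rewrite (boundary_face_sg hF hu Fz).2.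
  by apply: le_trans wt; exact: dot_sgvec_le.
Qed.

Lemma linear_min_normal (R : realType) (n : nat) (t : R) (g u : 'cV[R]_n) :
  0 < t -> g != 0 -> l1norm u = t -> (forall k, u k 0 != 0) ->
  (forall z, l1norm z <= t -> dot g u <= dot g z) ->
  exists2 c : R, 0 < c & g = - (c *: sgvec u).
Proof.
move=> t0 g0 ut nz hmin; pose a := dot g u / t.
have hg : g = a *: sgvec u.
  apply/colP => k; rewrite mxE -!dot_delta.
  set e := delta_mx k 0; pose s := dot (sgvec u) e.
  (* Subtracting this multiple of [u] moves [e] into the hyperplane [<sg u, v> = 0], which is the
     whole of [face_dir u] when [u] has no zero coordinate. *)
  have : dot g (e - (s / t) *: u) = 0.
    apply: (@linear_min_face_dir _ _ _ u); first by rewrite ut.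
    apply/face_dirP; split=> [i /eqP ui|]; first by rewrite (negPf (nz i)) in ui.
    by rewrite dotDr dotNr dotZr dot_sgvec_self ut divfK ?subrr // gt_eqF.
  rewrite dotDr dotNr dotZr => /eqP; rewrite subr_eq0 => /eqP ->.
  by rewrite -/s /a; ring.
exists (- a); last by rewrite scaleNr opprK.
rewrite oppr_gt0 lt_neqAle; apply/andP; split.
  by apply: contra g0 => /eqP a0; rewrite hg a0 scale0r.
rewrite /a pmulr_lle0 ?invr_gt0 //.
by have := hmin 0; rewrite l1norm0 dot0r; apply; exact: ltW.
Qed.

(** * The lasso estimate as point of contact *)

Theorem theorem3p1 (R : realType) (p N : nat) (x : 'I_N -> 'cV[R]_p)
    (y : 'I_N -> R) (t : R)
    (p_ge2 : (2 <= p)%N) (hcentered : centered x y) (hrank : full_rank x y)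
    (t_gt0 : 0 < t) (t_lt : t < t_hat x y) :
  (exists! beta, is_lasso x y t beta) /\
  (exists! mu, is_contact_level x y t mu) /\
  forall (beta : 'cV[R]_p) (mu : R),
    is_lasso x y t beta -> is_contact_level x y t mu ->
    [/\ ellipsoid x y mu `&` cross_boundary t = [set beta],
        forall F : set 'cV[R]_p,
          is_boundary_face t F -> has_aff_dim F (p - 1)%N -> relint F beta ->
          exists delta : 'cV[R]_p, is_face_normal t F delta /\
            exists c : R, 0 < c /\
              gradient (ellipsoid_fun x y) beta = - (c *: delta)
      & forall (F : set 'cV[R]_p) (j : nat),
          (j < p - 1)%N ->
          is_boundary_face t F -> has_aff_dim F j -> relint F beta ->
          #|[pred k : 'I_p | beta k 0 == 0]| = (p - 1 - j)%N /\
          exists H : set 'cV[R]_p,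
            is_tangent_hyperplane (ellipsoid_fun x y) beta H /\ F `<=` H].
Proof.
have p_gt0 : (0 < p)%N by exact: ltnW.
have N_gt0 := full_rank_gt0 p_gt0 hrank.
have Ku := K1_unit hrank.
pose g (beta : 'cV[R]_p) := K1 x *m (beta - beta_hat x y).
have hvar beta : is_lasso x y t beta ->
    forall z, l1norm z <= t -> dot (g beta) beta <= dot (g beta) z.
  move=> /(is_lasso_ellipsoid _ _ _ N_gt0 Ku)[bt hmin] z.
  exact: lasso_variational bt hmin.
(* Strictness yields the uniqueness of the estimate and, later, of the point of contact. *)
have hlt beta z : is_lasso x y t beta -> l1norm z <= t -> z != beta ->
    ellipsoid_fun x y beta < ellipsoid_fun x y z.
  by move=> hb zt; apply: (ellipsoid_fun_strict_min hrank); exact: hvar hb _ zt.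
have g_neq0 beta : is_lasso x y t beta -> g beta != 0.
  move=> [bt _]; apply/negP => /eqP g0.
  have : beta - beta_hat x y = 0 by rewrite -(mulKmx Ku (beta - _)) -/(g beta) g0 mulmx0.
  move=> /subr0_eq bE; move: t_lt; rewrite ltNge /t_hat -bE => /negP; exact.
have hbd beta : is_lasso x y t beta -> l1norm beta = t.
  by move=> hb; apply: (linear_min_boundary t_gt0 (g_neq0 _ hb) hb.1); exact: hvar.
have [b0 hb0] : exists beta, is_lasso x y t beta.
  have [b bt hb] := ellipsoid_fun_min_exists x y (ltW t_gt0).
  by exists b; apply/is_lasso_ellipsoid.
have uniq beta : is_lasso x y t beta -> beta = b0.
  move=> hb; apply/eqP/negPn/negP => ne.
  have := hlt _ _ hb0 hb.1 ne; rewrite eq_sym in ne.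
  by have := hlt _ _ hb hb0.1 ne => /lt_trans h /h; rewrite ltxx.
pose k := dot (invmx (K1 x) *m bvec x y) (bvec x y) - Jyy y.
(* The level whose ellipsoid passes through [b0]. *)
pose mu0 := ellipsoid_fun x y b0 - k.
have hmu0 : is_contact_level x y t mu0.
  split.
    by exists b0; split; [rewrite /ellipsoid /= -addrA -/k /mu0 subrK | exact: hbd].
  move=> m [z [zE zt]]; rewrite /mu0 lerBlDr.
  rewrite /ellipsoid /= -addrA -/k in zE; rewrite -zE.
  have [->//|ne] := eqVneq z b0; apply/ltW/hlt => //.
  by rewrite zt.
have mu_uniq mu : is_contact_level x y t mu -> mu = mu0.
  move=> [h1 h2]; apply/le_anti/andP; split; first exact: h2 hmu0.1.
  exact: hmu0.2 h1.
split; first by exists b0; split => // b /uniq.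
split; first by exists mu0; split => // m /mu_uniq.
move=> beta mu hb /mu_uniq -> {mu}.
have eb := uniq _ hb; rewrite {}eb {beta hb}.
have g_grad : gradient (ellipsoid_fun x y) b0 = 2 *: g b0 by exact: gradient_ellipsoid_fun.
split.
- apply/seteqP; split=> z.
    move=> [zE zt]; apply/eqP/negPn/negP => ne.
    rewrite /ellipsoid /= -addrA -/k subrK in zE.
    by have := hlt _ z hb0; rewrite zt lexx zE ltxx => /(_ isT ne).
  move=> ->; split; last exact: hbd.
  by rewrite /ellipsoid /= -addrA -/k subrK.
- move=> F hF hd hr; exists (sgvec b0).
  have hn := has_aff_dim_face_normal p_gt0 t_gt0 hF hd hr; split => //.
  (* The entries of the normal [sgvec b0] are 1 or -1, so no coordinate of [b0] vanishes. *)
  have nz i : b0 i 0 != 0.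
    by have [/(_ i) + _ _] := hn; rewrite mxE -sgr_eq0 => -[] ->; rewrite ?oppr_eq0 oner_eq0.
  have [c c0 gE] := linear_min_normal t_gt0 (g_neq0 _ hb0) (hbd _ hb0) nz (hvar _ hb0).
  by exists (2 * c); split; [rewrite mulr_gt0|rewrite g_grad gE scalerN scalerA].
- move=> F j _ hF hd hr; split.
    have := boundary_face_dim t_gt0 hF hr hd.
    by move: #|_| => m <-; rewrite addnA addnK addKn.
  exists [set z | dot (gradient (ellipsoid_fun x y) b0) (z - b0) = 0].
  split; first by split => //; rewrite g_grad scaler_eq0 pnatr_eq0 /= g_neq0.
  (* The difference [z - b0] lies in the direction of the face, on which [g b0] vanishes. *)
  move=> z Fz /=; rewrite g_grad dotZl (@linear_min_face_dir _ _ _ b0) ?mulr0 //.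
    by rewrite hbd //; exact: hvar.
  by have := sub_aff_hull Fz; rewrite (aff_hull_boundary_face hF hr).
Qed.
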